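(* Let $B$ and $B_q$ be topological (boundary) spaces and let $q:B\to B_q$ be a continuous surjection and quotient map. Let $D$ be a domain, let $K_q:D\times B_q\to[0,\infty]$ be measurable, and set $K(x,z):=K_q(x,q(z))$ for $x\in D$, $z\in B$. If a finite positive measure $\mu$ on $B$ represents a function $u$ on $D$ by $$u(x)=\int_BK(x,z)\,d\mu(z),\qquad x\in D,$$ then $$u(x)=\int_{B_q}K_q(x,\zeta)\,d(q_\#\mu)(\zeta),\qquad x\in D.$$ Conversely, if $\nu$ is a finite positive Radon measure on $B_q$ and $\widehat\nu$ is a finite positive Radon measure on $B$ satisfying $q_\#\widehat\nu=\nu$, then $K$ and $\widehat\nu$ give the corresponding representation on $B$: $\int_BK(x,z)\,d\widehat\nu(z)=\int_{B_q}K_q(x,\zeta)\,d\nu(\zeta)$ for every $x\in D$.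
   Context: A domain is a nonempty connected open subset of a first-countable Hausdorff space. Measures are Borel measures; the push-forward is $q_\#\mu(A)=\mu(q^{-1}(A))$. Measurability of $K_q$ is Borel measurability; in particular $\zeta\mapsto K_q(x,\zeta)$ is measurable on $B_q$ for each $x\in D$. *)

(* Defs.v *)
From HB Require Import structures.
From mathcomp Require Import all_boot all_order all_algebra.
From mathcomp Require Import all_classical all_reals all_analysis.
From mathcomp Require Import measurable_realfun.

Set Implicit Arguments.
Unset Strict Implicit.
Unset Printing Implicit Defensive.

Import Order.TTheory GRing.Theory Num.Theory.

Local Open Scope classical_set_scope.
Local Open Scope ring_scope.
Local Open Scope ereal_scope.

(* A pointed topology is required because every measurableType is pointed;
   mathematically this only says that the space is nonempty. *)
Notation borel T := (g_sigma_algebraType (@open T)).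

Definition first_countable (T : topologicalType) : Prop :=
  forall x : T, exists2 N : set (set T), countable N &
    N `<=` nbhs x /\
    (forall V, nbhs x V -> exists2 U, N U & U `<=` V).

Definition is_domain (T : topologicalType) (D : set T) : Prop :=
  [/\ D !=set0, connected D & open D].

Definition quotient_map (S T : topologicalType) (q : S -> T) : Prop :=
  set_surj [set: S] [set: T] q /\
  (forall V : set T, open V <-> open (q @^-1` V)).

(* Compact sets are required to be Borel explicitly since the space need not be
   Hausdorff (in a Hausdorff space this is automatic). *)
Definition radon (R : realType) (T : ptopologicalType)
    (mu : set (borel T) -> \bar R) : Prop :=
  (forall x : T, exists2 U : set T, open_nbhs x U & mu U < +oo) /\
  (forall A : set (borel T), measurable A ->
    mu A = ereal_sup [set mu C | C in
      [set C : set (borel T) |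
        [/\ compact (C : set T), measurable C & C `<=` A]]]).

(* K is a total function on X, but only its values on D `*` setT are
   constrained. As D is open, so is D `*` setT, and the Borel sets of the space
   D `*` setT are the Borel subsets of the product X * T contained in it. *)
Definition borel_kernel (R : realType) (X T : ptopologicalType) (D : set X)
    (K : X -> T -> \bar R) : Prop :=
  (forall x, D x -> forall z, 0 <= K x z) /\
  measurable_fun ((D `*` [set: T]) : set (borel (X * T)%type))
    (fun p : borel (X * T)%type => K p.1 p.2).

Definition represents (R : realType) (X T : ptopologicalType) (D : set X)
    (K : X -> T -> \bar R) (mu : set (borel T) -> \bar R)
    (u : X -> \bar R) : Prop :=
  forall x, D x -> u x = \int[mu]_(z in [set: borel T]) K x z.

(* Main.v *)
Require Import Defs.
From HB Require Import structures.
From mathcomp Require Import all_boot all_order all_algebra.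
From mathcomp Require Import all_classical all_reals all_analysis.
From mathcomp Require Import measurable_realfun.

Set Implicit Arguments.
Unset Strict Implicit.
Unset Printing Implicit Defensive.

Import Order.TTheory GRing.Theory Num.Theory.

Local Open Scope classical_set_scope.
Local Open Scope ring_scope.
Local Open Scope ereal_scope.

(** Both directions are the change of variables formula for a nonnegative
    Borel function [f] on [Bq] and the Borel map [q]:
    [\int[mu]_z f (q z) = \int[pushforward mu q]_zeta f zeta].
    Taking [f := Kq x] gives the first direction; for the second, the integral
    depends only on the values of the measure on Borel sets, where the
    push-forward of [nuhat] coincides with [nu].
    The point that needs an argument is that each slice [Kq x] with [x] in [D]
    is Borel on [Bq], although the hypothesis concerns the Borel sigma-algebra
    of the product space (which may be strictly larger than the product of the
    Borel sigma-algebras). It holds because the slice is the composition of the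
    kernel with the map [zeta |-> (x, zeta)], which is continuous, hence Borel
    for that larger sigma-algebra (lemma [borel_kernel_slice]). *)

(** The target is a bare pointed type with an arbitrary generator [G], rather
    than a pointed topological space, so that the lemma also covers the product
    [X * T], which carries its topology and its base point separately. *)
Lemma open_preimage_measurable (S : ptopologicalType) (T : pointedType)
    (G : set (set T)) (f : S -> T) :
  (forall U, G U -> open (f @^-1` U)) ->
  measurable_fun [set: borel S] (f : borel S -> g_sigma_algebraType G).
Proof.
move=> fG.
apply: (@measurability _ _ (borel S) (g_sigma_algebraType G) _ _ G) => //.
move=> _ [U GU <-]; rewrite setTI.
by apply: sub_sigma_algebra; exact: fG.
Qed.

Lemma continuous_borel_measurable (S T : ptopologicalType) (f : S -> T) :
  continuous f -> measurable_fun [set: borel S] (f : borel S -> borel T).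
Proof. by move=> /continuousP fcont; exact: open_preimage_measurable. Qed.

(** Being open, [D] makes the cylinder [D `*` setT] Borel, so measurability on
    it composes with the Borel map [zeta |-> (x, zeta)], whose range lies in
    that cylinder. *)
Lemma borel_kernel_slice (R : realType) (X T : ptopologicalType) (D : set X)
    (K : X -> T -> \bar R) (x : X) :
  open D -> borel_kernel D K -> D x ->
  measurable_fun [set: borel T] (K x : borel T -> \bar R).
Proof.
move=> oD [_ mK] Dx.
have pair_cont : continuous (fun z : T => (x, z)).
  by move=> z; apply: cvg_pair; [exact: cvg_cst|exact: cvg_id].
have mDT : measurable (D `*` [set: T] : set (borel (X * T)%type)).
  apply: sub_sigma_algebra.
  have -> : D `*` [set: T] = fst @^-1` D by rewrite -setXT.
  apply: open_comp oD => p _.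
  exact: cvg_fst.
apply: (@measurable_comp _ _ _ (borel T) (borel (X * T)%type) _
  _ _ _ (pair x) mDT _ mK).
- by move=> _ [z _ <-].
- by apply: open_preimage_measurable; exact/continuousP.
Qed.

Lemma integral_pushforward_kernel (R : realType) (X S T : ptopologicalType)
    (q : S -> T) (D : set X) (K : X -> T -> \bar R)
    (mu : {measure set (borel S) -> \bar R}) (x : X) :
  continuous q -> open D -> borel_kernel D K -> D x ->
  \int[pushforward mu (q : borel S -> borel T)]_(zeta in [set: borel T])
    K x zeta =
  \int[mu]_(z in [set: borel S]) K x (q z).
Proof.
move=> q_cont oD kK Dx.
rewrite ge0_integral_pushforward//.
- exact: continuous_borel_measurable.
- exact: borel_kernel_slice kK Dx.
- by move=> z _; exact: kK.1.
Qed.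

Theorem corollary4p14 (R : realType) (B Bq : ptopologicalType) (q : B -> Bq)
  (q_cont : continuous q) (q_surj : set_surj [set: B] [set: Bq] q)
  (q_quot : quotient_map q)
  (X : ptopologicalType) (X_fc : first_countable X) (X_haus : hausdorff_space X)
  (D : set X) (D_dom : is_domain D)
  (Kq : X -> Bq -> \bar R) (Kq_ker : borel_kernel D Kq) :
  let K := fun (x : X) (z : B) => Kq x (q z) in
  (forall (mu : {finite_measure set (borel B) -> \bar R}) (u : X -> \bar R),
     represents D K mu u ->
     represents D Kq (pushforward mu (q : borel B -> borel Bq)) u) /\
  (forall (nu : {finite_measure set (borel Bq) -> \bar R})
          (nuhat : {finite_measure set (borel B) -> \bar R}),
     radon nu -> radon nuhat ->
     (forall A : set (borel Bq), measurable A ->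
        pushforward nuhat (q : borel B -> borel Bq) A = nu A) ->
     forall x, D x ->
       \int[nuhat]_(z in [set: borel B]) K x z =
       \int[nu]_(zeta in [set: borel Bq]) Kq x zeta).
Proof.
case: D_dom => _ _ oD; split.
  move=> mu u repr_u x Dx.
  by rewrite repr_u// (integral_pushforward_kernel _ q_cont oD Kq_ker Dx).
move=> nu nuhat _ _ pushE x Dx.
rewrite -(integral_pushforward_kernel _ q_cont oD Kq_ker Dx).
(* Borel measurability of [q] is what makes the push-forward a measure, as the
   comparison of the two integrals requires. *)
have mq := continuous_borel_measurable q_cont.
apply: (eq_measure_integral nu) => // A mA _.
exact: pushE.
Qed.
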